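(* Let $\mathcal{B}=(\mathbf{x}_n)_{n=1}^\infty$ be a bidemocratic quasi-greedy basis of a quasi-Banach space $\mathbb{X}$. Then its Banach envelope $\mathcal{B}_{\mathsf{c}}=(J_{\mathbb{X}}(\mathbf{x}_n))_{n=1}^\infty$ is an almost greedy basis of the Banach envelope $\mathbb{X}_{\mathsf{c}}$ of $\mathbb{X}$.
   Context: The scalar field is $\mathbb{R}$ or $\mathbb{C}$. A quasi-norm satisfies the axioms of a norm except that the triangle inequality is replaced by $\Vert f+g\Vert\le\kappa(\Vert f\Vert+\Vert g\Vert)$ for some $\kappa\ge1$; a quasi-Banach space is a vector space complete for the topology of a quasi-norm. A basis of $\mathbb{X}$ is a sequence $\mathcal{B}=(\mathbf{x}_n)_{n=1}^\infty$ whose closed linear span is $\mathbb{X}$ and for which there is a (unique) sequence $\mathcal{B}^*=(\mathbf{x}_n^* )_{n=1}^\infty$ in $\mathbb{X}^*$ with $\mathbf{x}_n^*(\mathbf{x}_k)=\delta_{k,n}$. It is $M$-bounded if $\sup_n\Vert\mathbf{x}_n\Vert\,\Vert\mathbf{x}_n^*\Vert<\infty$ and semi-normalized if $0<\inf_n\Vert\mathbf{x}_n\Vert\le\sup_n\Vert\mathbf{x}_n\Vert<\infty$. For finite $A\subseteq\mathbb{N}$, $S_A(f)=\sum_{n\in A}\mathbf{x}_n^*(f)\mathbf{x}_n$. A set $A\subseteq\mathbb{N}$ is a greedy set of $f$ if $|\mathbf{x}_k^*(f)|\le|\mathbf{x}_n^*(f)|$ for all $n\in A$, $k\in\mathbb{N}\setminus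 A$. An $M$-bounded semi-normalized basis is quasi-greedy if there is $C<\infty$ with $\Vert S_A(f)\Vert\le C\Vert f\Vert$ for all $f$ and all finite greedy sets $A$ of $f$; it is almost greedy if there is $C$ with $\Vert f-S_A(f)\Vert\le C\Vert f-S_B(f)\Vert$ whenever $A$ is a finite greedy set of $f$ and $B\subseteq\mathbb{N}$ with $|B|\le|A|$. A basis is bidemocratic if there is $C$ such that $\left\Vert\sum_{n\in A}\mathbf{x}_n\right\Vert\,\left\Vert\sum_{n\in B}\mathbf{x}_n^*\right\Vert\le Cm$ for all $m\in\mathbb{N}$ and all $A,B\subseteq\mathbb{N}$ with $\max\{|A|,|B|\}\le m$. The Banach envelope of $\mathbb{X}$ is the pair $(\mathbb{X}_{\mathsf{c}},J_{\mathbb{X}})$, unique up to isometry, where $\mathbb{X}_{\mathsf{c}}$ is a Banach space and $J_{\mathbb{X}}\colon\mathbb{X}\to\mathbb{X}_{\mathsf{c}}$ is linear with $\Vert J_{\mathbb{X}}\Vert\le1$, such that for every Banach space $\mathbb{Y}$ and every bounded linear $T\colon\mathbb{X}\to\mathbb{Y}$ there is a unique bounded linear $S\colon\mathbb{X}_{\mathsf{c}}\to\mathbb{Y}$ with $S\circ J_{\mathbb{X}}=T$, and moreover $\Vert S\Vert\le\Vert T\Vert$. (Concretely, $J_{\mathbb{X}}$ is the canonical map $\mathbb{X}\to\mathbb{X}^{**}$ and $\mathbb{X}_{\mathsf{c}}$ the closed span of its range.) *)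

(* Defs.v *)
From HB Require Import structures.
From mathcomp Require Import all_boot all_order all_algebra finmap.
From mathcomp Require Import all_classical all_reals all_analysis.
From mathcomp.real_closed Require Import complex.

Set Implicit Arguments.
Unset Strict Implicit.
Unset Printing Implicit Defensive.

Import Order.TTheory GRing.Theory Num.Theory.
Import numFieldNormedType.Exports.

Local Open Scope classical_set_scope.
Local Open Scope ring_scope.

(* Following MathComp-Analysis, norms take their values in the scalar field K.
   For K = R[i], a <= b means that b - a is a nonnegative real number, so a
   quantity bounded below by 0 is a nonnegative real, and every bound on it is
   real as well. *)
Definition real_or_complex (K : numFieldType) : Prop :=
  exists R : realType,
    K = (R : numFieldType) \/ K = (R[i]%C : numFieldType).

Section QuasiBanach.
Variables (K : numFieldType) (V : lmodType K) (q : V -> K).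

Definition quasi_norm : Prop :=
  [/\ forall f, 0 <= q f,
      forall f, q f = 0 -> f = 0,
      forall (a : K) f, q (a *: f) = `|a| * q f &
      exists2 kappa : K, 1 <= kappa &
        forall f g, q (f + g) <= kappa * (q f + q g)].

(* The topology of q is metrizable, so that completeness is sequential. *)
Definition quasi_complete : Prop :=
  forall u : nat -> V,
    (forall e : K, 0 < e -> exists N : nat,
       forall i j : nat, (N <= i)%N -> (N <= j)%N -> q (u i - u j) < e) ->
    exists l : V, forall e : K, 0 < e -> exists N : nat,
      forall i : nat, (N <= i)%N -> q (u i - l) < e.

Definition quasi_banach : Prop := quasi_norm /\ quasi_complete.

End QuasiBanach.

Section Operators.
Variables (K : numFieldType) (V W : Type) (NV : V -> K) (NW : W -> K).

Definition op_bounded (T : V -> W) : Prop :=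
  exists C : K, forall f, NW (T f) <= C * NV f.

(* The junk value is 0 when T is unbounded, so op_norm is only meaningful for
   maps satisfying op_bounded. For K = R[i], the least upper bound in the
   partial order of R[i] of a nonempty bounded set of nonnegative reals is its
   real supremum. *)
Definition op_norm (T : V -> W) : K :=
  supremum 0 [set NW (T f) | f in [set f | NV f <= 1]].

End Operators.

Section Bases.
Variables (K : numFieldType) (V : lmodType K) (q : V -> K).
Variables (x : nat -> V) (xs : nat -> {scalar V}).

Definition dual_norm (phi : V -> K) : K :=
  op_norm q (fun a : K => `|a|) phi.

(* x is a basis with coordinate functionals xs; xs is determined by x. *)
Definition is_basis : Prop :=
  [/\ forall (f : V) (e : K), 0 < e -> exists (n : nat) (c : nat -> K),
        q (f - \sum_(i < n) c i *: x i) < e,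
      forall n, op_bounded q (fun a : K => `|a|) (xs n) &
      forall n k, xs n (x k) = (k == n)%:R].

Definition M_bounded : Prop :=
  exists C : K, forall n, q (x n) * dual_norm (xs n) <= C.

Definition semi_normalized : Prop :=
  exists c C : K, 0 < c /\ forall n, c <= q (x n) /\ q (x n) <= C.

Definition coord_proj (A : {fset nat}) (f : V) : V :=
  \sum_(n <- A) xs n f *: x n.

Definition greedy_set (A : {fset nat}) (f : V) : Prop :=
  forall n k : nat, n \in A -> k \notin A -> `|xs k f| <= `|xs n f|.

Definition quasi_greedy_basis : Prop :=
  [/\ is_basis, M_bounded, semi_normalized &
      exists C : K, forall (f : V) (A : {fset nat}), greedy_set A f ->
        q (coord_proj A f) <= C * q f].

Definition almost_greedy_basis : Prop :=
  [/\ is_basis, M_bounded, semi_normalized &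
      exists C : K, forall (f : V) (A B : {fset nat}),
        greedy_set A f -> (#|` B| <= #|` A|)%N ->
        q (f - coord_proj A f) <= C * q (f - coord_proj B f)].

Definition bidemocratic_basis : Prop :=
  is_basis /\
  exists C : K, forall (m : nat) (A B : {fset nat}),
    (maxn #|` A| #|` B| <= m)%N ->
    q (\sum_(n <- A) x n) * dual_norm (fun f => \sum_(n <- B) xs n f)
      <= C * m%:R.

End Bases.

Definition is_banach_envelope (K : numFieldType) (X : lmodType K) (q : X -> K)
    (Xc : completeNormedModType K) (J : {linear X -> Xc}) : Prop :=
  [/\ op_bounded q (fun y : Xc => `|y|) J,
      op_norm q (fun y : Xc => `|y|) J <= 1 &
      forall (Y : completeNormedModType K) (T : {linear X -> Y}),
        op_bounded q (fun y : Y => `|y|) T ->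
        exists S : {linear Xc -> Y},
          [/\ op_bounded (fun y : Xc => `|y|) (fun y : Y => `|y|) S,
              forall f, S (J f) = T f,
              op_norm (fun y : Xc => `|y|) (fun y : Y => `|y|) S
                <= op_norm q (fun y : Y => `|y|) T &
              forall S' : {linear Xc -> Y},
                op_bounded (fun y : Xc => `|y|) (fun y : Y => `|y|) S' ->
                (forall f, S' (J f) = T f) -> S' =1 S]].

(* Main.v *)
(* For a vector with coefficients al and a functional with coefficients be, the
   sum of al n * be n over A equals the sum over another set B of the same size
   up to the sums over A \ B and B \ A. If A is greedy for al and B is greedy
   for be, bidemocracy bounds these two errors.
   This exchange is applied twice. First, X is quasi-greedy, so that exchanging
   a greedy set of a functional with a greedy set of f shows that greedy
   projections of functionals on X are uniformly bounded; these bounds pass to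
   the Banach envelope by its universal property. Second, given y in the
   envelope and a greedy set A of y, a functional F norming S_A(y) exists by
   Hahn-Banach, and exchanging A with a greedy set of F bounds ||S_A(y)|| by
   ||y||. As F need not have null coefficients, sets which are greedy up to the
   factor 2 are used for functionals.
   Quasi-greediness and bidemocracy of the envelope give almost greediness: with
   g = y - S_B(y), A \ B is a greedy set of g and
   y - S_A(y) = g - S_{A \ B}(g) + S_{B \ A}(y). *)

From HB Require Import structures.
Require Import Defs.
From mathcomp Require Import all_boot all_order all_algebra finmap.
From mathcomp Require Import all_classical all_reals all_analysis.
From mathcomp.real_closed Require Import complex.
From mathcomp Require Import ring.

Set Implicit Arguments.
Unset Strict Implicit.
Unset Printing Implicit Defensive.

Import Order.TTheory GRing.Theory Num.Theory.
Import numFieldNormedType.Exports.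

Local Open Scope classical_set_scope.
Local Open Scope ring_scope.

(** * Real and complex scalars *)

(** Order completeness in a form that makes sense for the partial order of [R[i]], where only
    numbers with equal imaginary parts are comparable. *)
Definition real_sup_property (K : numFieldType) : Prop :=
  forall E : set K, E !=set0 -> (forall a, E a -> a \is Num.real) ->
    ubound E !=set0 -> supremums E !=set0.

(* I is 0 over the reals and i over the complex numbers. The equation
   I * (I * s) = - s forces s = 0 when I = 0, which makes a real-linear
   functional u complexify to u f - I * u (I f) uniformly in both cases. *)
Definition imaginary_unit (K : numFieldType) (I : K) : Prop :=
  [/\ `|I| <= 1,
      forall a : K, exists r s : K, [/\ r \is Num.real, s \is Num.real,
        a = r + I * s & I * (I * s) = - s] &
      forall r s : K, r \is Num.real -> s \is Num.real ->
        `|r| <= `|r + I * s| /\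
        (I * (I * s) = - s -> `|s| <= `|r + I * s|)].

Lemma real_sup_realType (R : realType) : real_sup_property R.
Proof.
move=> E E0 _ [u uE]; exists (sup E); split.
  exact: (@ub_le_sup R E (ex_intro _ u uE)).
by move=> v vE; apply: ge_sup.
Qed.

(** An upper bound of a nonempty set of reals is comparable to a real, hence real itself; so the
    supremum of the real parts is the least one. *)
Lemma real_sup_complex (R : realType) : real_sup_property R[i]%C.
Proof.
move=> E [a0 Ea0] Er [u uE].
have [s [s1 s2]] : supremums [set complex.Re a | a in E] !=set0.
  apply: (@real_sup_realType R).
  - by exists (complex.Re a0), a0.
  - by move=> a _; exact: num_real.
  exists (complex.Re u) => _ [a Ea <-].
  by have := uE _ Ea; rewrite lecE => /andP[].
exists (s%:C)%C; split.
  move=> a Ea; rewrite -(RRe_real (Er _ Ea)) lecR.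
  by apply: s1; exists a.
move=> v vE; rewrite lecE /=.
have -> : complex.Im v = 0.
  have := vE _ Ea0; rewrite lecE => /andP[/eqP -> _].
  by rewrite -(RRe_real (Er _ Ea0)).
rewrite eqxx /=; apply: s2 => _ [a Ea <-].
by have := vE _ Ea; rewrite lecE => /andP[].
Qed.

Lemma imaginary_unit_realType (R : realType) : imaginary_unit (0 : R).
Proof.
split; first by rewrite normr0.
  by move=> a; exists a, 0; rewrite !num_real !mul0r oppr0 addr0.
move=> r s _ _; rewrite !mul0r addr0; split=> // /eqP.
by rewrite eq_sym oppr_eq0 => /eqP ->; rewrite normr0.
Qed.

Lemma imaginary_unit_complex (R : realType) : imaginary_unit ('i%C : R[i]%C).
Proof.
split.
- by rewrite normc_def /= expr0n expr1n add0r sqrtr1.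
- move=> a; exists (complex.Re a)%:C%C, (complex.Im a)%:C%C.
  split; rewrite ?complex_real //; first exact: complexE.
  by rewrite mulrA -expr2 sqr_i mulN1r.
- move=> _ _ /complex_realP[r ->] /complex_realP[s ->].
  have nE (t : R) : `|t%:C%C| = (`|t|%:C)%C.
    by rewrite normc_def /= expr0n addr0 sqrtr_sqr.
  have -> : (r%:C + 'i * s%:C = r +i* s)%C by rewrite [RHS]complexE.
  rewrite !nE normc_def /= !lecR -!sqrtr_sqr.
  by split=> [|_]; apply: ler_wsqrtr; rewrite ?lerDl ?lerDr sqr_ge0.
Qed.

(** The real and imaginary parts are additive and do not increase the modulus, so they send a Cauchy
    filter to Cauchy filters of [R]. *)
Lemma complex_complete (R : realType) (F : set_system R[i]%C^o) :
  ProperFilter F -> cauchy F -> cvg F.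
Proof.
move=> FF /cauchyP Fc.
have part (p : R[i]%C -> R) : (forall a b, p (a - b) = p a - p b) ->
    (forall z, `|p z|%:C%C <= `|z|) -> cvg (p @ F).
  move=> pB pz; apply: R_complete; apply/cauchyP => e e0.
  have [|z Fz] := Fc e%:C%C; first by rewrite /= ltcR.
  exists (p z); rewrite /fmap /=.
  apply: (filterS _ Fz) => y; rewrite /preimage -!ball_normE /= => zy.
  by rewrite -ltcR -pB; exact: le_lt_trans (pz _) zy.
have imz (z : R[i]%C) : `|complex.Im z|%:C%C <= `|z|.
  by rewrite normc_def lecR -sqrtr_sqr ler_wsqrtr// lerDr sqr_ge0.
have /cvg_ex[/= a Fa] : cvg (@complex.Re R @ F).
  by apply: part; [move=> [? ?] [? ?]|exact: normc_ge_Re].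
have /cvg_ex[/= b Fb] : cvg (@complex.Im R @ F).
  by apply: part imz => - [? ?] [? ?].
apply/cvg_ex; exists ((a +i* b)%C : R[i]%C^o).
apply/cvgrPdist_lt => /= e; rewrite ltcE /= => /andP[/eqP ei e0].
have -> : e = (complex.Re e)%:C%C by case: e ei {e0} => ? ? /= ->.
have e2 : 0 < complex.Re e / 2 by rewrite divr_gt0.
move/cvgrPdist_lt : Fa => /(_ _ e2) Fa; move/cvgrPdist_lt : Fb => /(_ _ e2) Fb.
near=> z.
have -> : (a +i* b)%C - z = (a - complex.Re z)%:C%C + 'i%C * (b - complex.Im z)%:C%C.
  by rewrite [LHS]complexE; case: (z).
apply: le_lt_trans (ler_normD _ _) _.
have [i1 _ _] := imaginary_unit_complex R.
apply: (@le_lt_trans _ _ (`|a - complex.Re z|%:C%C + `|b - complex.Im z|%:C%C)).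
  have nE (t : R) : `|t%:C%C| = (`|t|%:C)%C.
    by rewrite normc_def /= expr0n addr0 sqrtr_sqr.
  rewrite nE normrM nE lerD2l -[leRHS]mul1r ler_wpM2r //.
  by rewrite ler0c.
rewrite -rmorphD /= ltcR [ltRHS]splitr ltrD//.
  by near: z.
by near: z.
Unshelve. all: by end_near. Qed.

Lemma real_or_complex_complete (K : numFieldType) : real_or_complex K ->
  forall F : set_system K^o, ProperFilter F -> cauchy F -> cvg F.
Proof. by case=> R [->|->]; [exact: R_complete|exact: complex_complete]. Qed.

Lemma real_or_complex_sup (K : numFieldType) :
  real_or_complex K -> real_sup_property K.
Proof. by case=> R [->|->]; [exact: real_sup_realType|exact: real_sup_complex]. Qed.

Lemma real_or_complex_imaginary_unit (K : numFieldType) :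
  real_or_complex K -> exists I : K, imaginary_unit I.
Proof.
case=> R [->|->]; first by exists 0; exact: imaginary_unit_realType.
by exists 'i%C; exact: imaginary_unit_complex.
Qed.

(* The scalar field as a Banach space: hK is a phantom argument that lets
   canonical structure inference find the completeness of K. *)
Definition banach_scalars (K : numFieldType) (hK : real_or_complex K) : Type :=
  K^o.

HB.instance Definition _ (K : numFieldType) (hK : real_or_complex K) :=
  NormedModule.copy (banach_scalars hK) K^o.
HB.instance Definition _ (K : numFieldType) (hK : real_or_complex K) :=
  Uniform_isComplete.Build (banach_scalars hK) (real_or_complex_complete hK).

(** * Sums with bounded coefficients *)

Section Sums.
Variables (K : numFieldType) (V : normedModType K) (T : choiceType).
Implicit Types (A B D E : {fset T}) (v : T -> V) (s : seq T).

(** The sum is affine in each coefficient, so its norm is largest at coefficients 0 and 1. In the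
    induction, [w] collects the terms whose coefficient has already become 0 or 1. *)
Lemma norm_convex_sum_le s v (a : T -> K) (w : V) (b : K) : uniq s ->
  (forall n, n \in s -> 0 <= a n <= 1) ->
  (forall d : pred T, `|w + \sum_(n <- s | d n) v n| <= b) ->
  `|w + \sum_(n <- s) a n *: v n| <= b.
Proof.
elim: s w => [|t s IH] w; first by move=> _ _ /(_ predT); rewrite !big_nil.
move=> /= /andP[ts us] a01 wb; rewrite big_cons.
have /andP[a0 a1] := a01 t (mem_head _ _).
have a01' n : n \in s -> 0 <= a n <= 1.
  by move=> ns; apply: a01; rewrite in_cons ns orbT.
(* As [t] is not in [s], a predicate can be modified at [t] so as to omit [v t] or include it,
   without changing the sum over [s]. *)
have eq_s (d d' : pred T) : (forall n, n != t -> d n = d' n) ->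
    \sum_(n <- s | d n) v n = \sum_(n <- s | d' n) v n.
  move=> dd'; rewrite big_seq_cond [RHS]big_seq_cond; apply: eq_bigl => n /=.
  by case: (boolP (n \in s)) => //= ns; apply: dd'; apply: contraNneq ts => <-.
have H1 := IH w us a01' _.
have H2 := IH (w + v t) us a01' _.
set S := \sum_(n <- s) a n *: v n in H1 H2 *.
have -> : w + (a t *: v t + S) = (1 - a t) *: (w + S) + a t *: (w + v t + S).
  by rewrite (addrAC w) (scalerDr _ (w + S)) [RHS]addrA -scalerDl subrK scale1r -addrA (addrC S).
apply: le_trans (ler_normD _ _) _; rewrite !normrZ (ger0_norm a0).
rewrite ger0_norm ?subr_ge0//.
have -> : b = (1 - a t) * b + a t * b by rewrite -mulrDl subrK mul1r.
apply: lerD; apply: ler_wpM2l; rewrite ?subr_ge0//.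
  apply: H1 => d; rewrite (eq_s _ (fun n => (n != t) && d n)).
    by have := wb (fun n => (n != t) && d n); rewrite big_cons /= eqxx.
  by move=> n ->.
apply: H2 => d; rewrite (eq_s _ (fun n => (n == t) || d n)).
  have := wb (fun n => (n == t) || d n); rewrite big_cons /= eqxx/=.
  by rewrite addrA.
by move=> n /negPf ->.
Qed.

Lemma sum_fsetID (W : zmodType) A B (c : T -> W) :
  \sum_(n <- A) c n
    = \sum_(n <- (A `&` B)%fset) c n + \sum_(n <- (A `\` B)%fset) c n.
Proof.
rewrite (big_fsetID _ (mem B)) /=.
by congr (_ + _); apply: eq_fbig => // n; rewrite !inE // andbC.
Qed.

Lemma sum_fsetB (W : zmodType) A B (c : T -> W) :
  \sum_(n <- A) c n - \sum_(n <- B) c n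
    = \sum_(n <- (A `\` B)%fset) c n - \sum_(n <- (B `\` A)%fset) c n.
Proof.
rewrite (sum_fsetID A B) (sum_fsetID B A) fsetIC opprD addrACA subrr add0r.
by [].
Qed.

Lemma real_lerNnorm (r : K) : r \is Num.real -> - r <= `|r|.
Proof. by move=> rr; rewrite -normrN real_ler_norm ?rpredN. Qed.

(** The factor 4 comes from two splittings: each coefficient into real and imaginary parts, then
    each of these into a positive and a negative part with values in [0, 1]. *)
Lemma norm_unit_sum_le (I : K) A v (a : T -> K) (b : K) :
  imaginary_unit I -> (forall n, n \in A -> `|a n| <= 1) ->
  (forall D, (D `<=` A)%fset -> `|\sum_(n <- D) v n| <= b) ->
  `|\sum_(n <- A) a n *: v n| <= 4 * b.
Proof.
move=> [I1 dec normI] a1 Db.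
have cb (c : T -> K) : (forall n, n \in A -> 0 <= c n <= 1) ->
    `|\sum_(n <- A) c n *: v n| <= b.
  move=> c01; rewrite -[X in `|X|]add0r.
  apply: norm_convex_sum_le; rewrite ?fset_uniq// => d; rewrite add0r.
  rewrite big_fset_condE; apply: Db; apply/fsubsetP => n.
  by rewrite !inE => /andP[].
have rb (r : T -> K) : (forall n, n \in A -> r n \is Num.real /\ `|r n| <= 1) ->
    `|\sum_(n <- A) r n *: v n| <= 2 * b.
  move=> r1.
  have -> : \sum_(n <- A) r n *: v n =
      \sum_(n <- A) ((`|r n| + r n) / 2) *: v n
      - \sum_(n <- A) ((`|r n| - r n) / 2) *: v n.
    rewrite -sumrB; apply: eq_bigr => n _; rewrite -scalerBl; congr (_ *: _).
    by rewrite -mulrBl opprD opprK addrACA subrr add0r mulrDl -splitr.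
  apply: le_trans (ler_normB _ _) _; rewrite mulr_natl.
  rewrite [leRHS]mulr2n; apply: lerD; apply: cb => n /r1[rr r1n].
    rewrite divr_ge0 ?ler0n//=; last by rewrite -[X in _ + X]opprK subr_ge0 real_lerNnorm.
    rewrite ler_pdivrMr ?ltr0n// mul1r. rewrite mulr2n lerD//.
    by apply: le_trans (real_ler_norm rr) r1n.
  rewrite divr_ge0 ?subr_ge0 ?ler0n ?real_ler_norm//=.
  rewrite ler_pdivrMr ?ltr0n// mul1r mulr2n lerD//.
  exact: le_trans (real_lerNnorm rr) r1n.
have /choice[r /choice[s rs]] := dec.
have le_rs n : `|r (a n)| <= `|a n| /\ `|s (a n)| <= `|a n|.
  by have [r_ s_ e Is] := rs (a n); have [H1 /(_ Is) H2] := normI _ _ r_ s_; rewrite -e in H1 H2.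
have -> : \sum_(n <- A) a n *: v n =
    \sum_(n <- A) r (a n) *: v n + I *: \sum_(n <- A) s (a n) *: v n.
  rewrite scaler_sumr -big_split; apply: eq_bigr => n _ /=.
  by rewrite scalerA -scalerDl; have [_ _ <-] := rs (a n).
have -> : 4 * b = 2 * b + 2 * b by rewrite -mulrDl -natrD.
apply: le_trans (ler_normD _ _) _; apply: lerD.
  apply: rb => n nA; have [r_ _ _ _] := rs (a n).
  by have [+ _] := le_rs n; split=> //; exact: le_trans (a1 _ nA).
rewrite normrZ -[leRHS]mul1r; apply: ler_pM => //; apply: rb => n nA.
have [_ s_ _ _] := rs (a n).
by have [_ +] := le_rs n; split=> //; exact: le_trans (a1 _ nA).
Qed.

End Sums.

(** * Bilinear sums and the exchange of greedy sets *)

Section Bilinear.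
Variables (K : numFieldType) (I : K) (hI : imaginary_unit I) (T : choiceType).
Implicit Types (A B D E : {fset T}).

Lemma norm_bounded_sum_le (V : normedModType K) A (v : T -> V) (a : T -> K)
    (s b : K) : 0 <= s -> (forall n, n \in A -> `|a n| <= s) ->
  (forall D, (D `<=` A)%fset -> `|\sum_(n <- D) v n| <= b) ->
  `|\sum_(n <- A) a n *: v n| <= 4 * (s * b).
Proof.
rewrite le_eqVlt => /predU1P[<-|s0] as_ Db.
  rewrite big_seq big1 ?normr0 => [|n /as_].
    by rewrite mul0r mulr0.
  by rewrite normr_le0 => /eqP ->; rewrite scale0r.
have -> : \sum_(n <- A) a n *: v n = s *: \sum_(n <- A) (a n / s) *: v n.
  rewrite scaler_sumr; apply: eq_bigr => n _.
  by rewrite scalerA mulrC divfK ?gt_eqF.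
rewrite normrZ gtr0_norm// mulrCA ler_pM2l//.
apply: norm_unit_sum_le hI _ Db => n nA.
by rewrite normrM normfV (gtr0_norm s0) ler_pdivrMr// mul1r as_.
Qed.

(* Averaging over D, |a n| is at most lam / #|D| times the sum of the |w k|,
   and that sum is itself a combination of the w k with unimodular
   coefficients. *)
Lemma norm_bilinear_sum_le (V : normedModType K) E D (u : T -> V)
    (w a : T -> K) (M lam : K) : (0 < #|` D|)%N -> 0 <= lam ->
  (forall E' D', (E' `<=` E)%fset -> (D' `<=` D)%fset ->
     `|\sum_(n <- E') u n| * `|\sum_(k <- D') w k| <= M * #|` D|%:R) ->
  (forall n k, n \in E -> k \in D -> `|a n| <= lam * `|w k|) ->
  `|\sum_(n <- E) a n *: u n| <= 16 * (lam * M).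
Proof.
move=> D0 lam0 uw aw; set d : K := #|` D|%:R in uw.
have d0 : 0 < d by rewrite ltr0n.
set W := \sum_(k <- D) `|w k|.
have W0 : 0 <= W by apply: sumr_ge0 => k _; exact: normr_ge0.
have M0 : 0 <= M.
  rewrite -(pmulr_lge0 _ d0).
  by apply: le_trans (uw fset0 fset0 (fsub0set _) (fsub0set _)); rewrite mulr_ge0.
have uW E' : (E' `<=` E)%fset -> `|\sum_(n <- E') u n| * W <= 4 * (M * d).
  move=> E'E; set U := `|_|.
  have U0 : 0 <= U by exact: normr_ge0.
  (* [th k] is unimodular, except that it is 0 when [w k] is 0, since division by 0 gives 0. *)
  pose th k := `|w k| / w k.
  have -> : U * W = `|\sum_(k <- D) th k *: (U * w k : K^o)|.
    rewrite -[LHS]ger0_norm ?mulr_ge0// mulr_sumr; congr `|_|.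
    apply: eq_bigr => k _; rewrite /GRing.scale/= mulrCA /th.
    have [->|wk] := eqVneq (w k) 0; first by rewrite normr0 !mul0r.
    by rewrite divfK.
  rewrite -[M * d]mul1r; apply: norm_bounded_sum_le => // [k _|D' D'D].
    rewrite /th normrM normfV normr_id.
    have [->|wk] := eqVneq (w k) 0; first by rewrite normr0 mul0r.
    by rewrite divff// normr_eq0.
  by rewrite -mulr_sumr normrM (ger0_norm U0) uw.
have aW n : n \in E -> `|a n| <= lam * W / d.
  move=> nE; rewrite ler_pdivlMr// mulr_natr /W mulr_sumr.
  rewrite -iter_addr_0 -count_predT -big_const_seq big_seq [leRHS]big_seq.
  by apply: ler_sum => k kD; exact: aw.
have [W_eq0|W_neq0] := eqVneq W 0.
  rewrite big_seq big1 ?normr0 ?mulr_ge0// => n /aW.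
  by rewrite W_eq0 mulr0 mul0r normr_le0 => /eqP ->; rewrite scale0r.
have W_gt0 : 0 < W by rewrite lt_def W_neq0.
have lWd : 0 <= lam * W / d by rewrite divr_ge0 ?mulr_ge0 ?(ltW d0).
(* Coefficients of size [lam * W / d] meet partial sums of size [4 * (M * d) / W]; [W] and [d]
   cancel, and 16 is 4 times 4. *)
apply: le_trans (norm_bounded_sum_le (b := 4 * (M * d) / W) lWd aW _) _.
  by move=> E' E'E; rewrite ler_pdivlMr// uW.
rewrite le_eqVlt; apply/orP; left; apply/eqP.
by field; rewrite W_neq0 gt_eqF.
Qed.

(* On A \ B the be n, and on B \ A the al n, are controlled by the larger
   coefficients of the same sequence on the other difference. *)
Lemma norm_greedy_swap A B (al be : T -> K) (M lam : K) : 1 <= lam ->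
  #|` A| = #|` B| ->
  (forall n k, n \in A -> k \notin A -> `|al k| <= lam * `|al n|) ->
  (forall n k, n \in B -> k \notin B -> `|be k| <= lam * `|be n|) ->
  (forall m D E, (#|` D| <= m)%N -> (#|` E| <= m)%N ->
    `|\sum_(n <- D) al n| * `|\sum_(k <- E) be k| <= M * m%:R) ->
  `|\sum_(n <- A) al n * be n|
    <= `|\sum_(n <- B) al n * be n| + 32 * (lam * M).
Proof.
move=> lam1 AB grA grB albe.
have lam0 : 0 <= lam by apply: le_trans lam1.
have M0 : 0 <= M.
  have := albe 1%N fset0 fset0 isT isT; rewrite !big_seq_fset0 mulr1.
  by rewrite normr0 mulr0.
have cAB : #|` (A `\` B)%fset| = #|` (B `\` A)%fset|.
  by rewrite !cardfsD fsetIC AB.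
rewrite -[X in `|X|](subrK (\sum_(n <- B) al n * be n)) addrC.
apply: le_trans (ler_normD _ _) _; rewrite lerD2l sum_fsetB.
(* The averaging argument divides by the number of elements of a difference; if one difference is
   empty, so is the other. *)
have [D0|D0] := posnP #|` (A `\` B)%fset|.
  rewrite (cardfs0_eq D0) (cardfs0_eq (_ : #|` (B `\` A)%fset| = 0%N)) -?cAB//.
  by rewrite big_seq_fset0 subrr normr0 !mulr_ge0.
apply: le_trans (ler_normB _ _) _.
have -> : 32 * (lam * M) = 16 * (lam * M) + 16 * (lam * M).
  by rewrite -mulrDl -natrD.
have sub X Y : (X `<=` Y)%fset -> (#|` X| <= #|` Y|)%N := @fsubset_leq_card _ X Y.
apply: lerD.
  under eq_bigr do rewrite mulrC.
  apply: (@norm_bilinear_sum_le K^o _ (B `\` A)%fset al be be) => //.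
  - by rewrite -cAB.
  - by move=> E' D' /sub cE /sub cD; apply: albe; rewrite // -cAB.
  - by move=> n k; rewrite !inE => /andP[nB nA] /andP[kA kB]; exact: grB.
apply: (@norm_bilinear_sum_le K^o _ (A `\` B)%fset be al al) => //.
- move=> E' D' /sub cE /sub cD; rewrite mulrC; apply: albe => //.
  by rewrite cAB.
- by move=> n k; rewrite !inE => /andP[nB nA] /andP[kA kB]; exact: grA.
Qed.

End Bilinear.

(** * Existence of greedy sets *)

Lemma fset_nat_fresh (A : {fset nat}) : exists t, t \notin A.
Proof.
exists (\max_(n <- A) n).+1; apply/negP => tA.
by have := @leq_bigmax_seq _ _ xpredT id _ tA isT; rewrite ltnn.
Qed.

Section GreedySets.
Variables (K : numFieldType) (v : nat -> K).
Hypothesis v0 : forall n, 0 <= v n.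

(** Near-maximal indices are adjoined one at a time. Earlier members keep dominating because the
    complement only shrinks. *)
Lemma greedy_fset_exists (lam : K) (m : nat) : 1 <= lam ->
  (forall A : {fset nat}, exists2 n, n \notin A &
     forall k, k \notin A -> v k <= lam * v n) ->
  exists2 A : {fset nat}, #|` A| = m &
    forall n k, n \in A -> k \notin A -> v k <= lam * v n.
Proof.
move=> lam1 step; elim: m => [|m [A Am Agr]]; first by exists fset0.
have [t tA tgr] := step A.
exists (t |` A)%fset; first by rewrite cardfsU1 tA Am.
move=> n k; rewrite !inE negb_or => nA /andP[_ kA].
by case/predU1P: nA => [->|nA]; [exact: tgr|exact: Agr].
Qed.

(** The supremum off [A] may not be attained, but if it is positive some value exceeds half of it;
    hence the factor 2. *)
Lemma bounded_near_max (b : K) : real_sup_property K -> (forall n, v n <= b) ->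
  forall A : {fset nat}, exists2 n, n \notin A &
    forall k, k \notin A -> v k <= 2 * v n.
Proof.
move=> supK vb A; have [t tA] := fset_nat_fresh A.
have [|a [n _ <-]||s [s1 s2]] := supK [set v n | n in [set n | n \notin A]].
- by exists (v t), t.
- by rewrite ger0_real.
- by exists b => _ [n _ <-].
have le_s n : n \notin A -> v n <= s by move=> nA; apply: s1; exists n.
have [s_eq0|s_neq0] := eqVneq s 0.
  exists t => // k /le_s; rewrite s_eq0 => vk; apply: le_trans vk _.
  by rewrite mulr_ge0.
have s_gt0 : 0 < s by rewrite lt_def s_neq0 (le_trans (v0 t) (le_s _ tA)).
have [n [nA nv]] : exists n, n \notin A /\ ~~ (v n <= s / 2).
  apply: contrapT => no; suff : s <= s / 2.
    rewrite ler_pdivlMr// mulr2n mulrDr mulr1 gerDl.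
    by rewrite lt_geF.
  apply: s2 => _ [n nA <-]; apply: contrapT => /negP vn.
  by apply: no; exists n.
exists n => // k /le_s vk; apply: le_trans vk _.
move: nv; rewrite -real_ltNge ?ger0_real ?divr_ge0// ?(ltW s_gt0)//.
by rewrite ltr_pdivrMr// mulrC => /ltW.
Qed.

Lemma seq_max_exists (s : seq nat) t : t \in s ->
  exists2 n, n \in s & forall k, k \in s -> v k <= v n.
Proof.
elim: s t => // a s IH t _; case: s IH => [|b s] IH.
  by exists a; rewrite ?mem_head// => k; rewrite inE => /eqP ->.
have [n ns nmax] := IH b (mem_head _ _).
have [an|na] := real_leP (ger0_real (v0 a)) (ger0_real (v0 n)).
  exists n; first by rewrite in_cons ns orbT.
  by move=> k; rewrite in_cons => /predU1P[->//|/nmax].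
exists a; first exact: mem_head.
move=> k; rewrite in_cons => /predU1P[->//|/nmax vk].
exact: le_trans vk (ltW na).
Qed.

(** If some value [v k0] off [A] is nonzero, only finitely many values reach it, and the maximum is
    taken over these. *)
Lemma null_seq_max : (forall e, 0 < e -> exists N, forall n, (N <= n)%N -> v n < e) ->
  forall A : {fset nat}, exists2 n, n \notin A &
    forall k, k \notin A -> v k <= v n.
Proof.
move=> v_null A; have [t tA] := fset_nat_fresh A.
have [[k0 [k0A vk0]]|none] := pselect (exists k, k \notin A /\ v k != 0); last first.
  exists t => // k kA; suff -> : v k = 0 by [].
  by apply: contrapT => /eqP vk; apply: none; exists k.
have vk0_gt0 : 0 < v k0 by rewrite lt_def vk0 v0.
have [N Nv] := v_null _ vk0_gt0.
have mem_s k : (k \in [seq k <- iota 0 N | k \notin A]) = (k \notin A) && (k < N)%N.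
  by rewrite mem_filter mem_iota.
have lt_N k : v k0 <= v k -> (k < N)%N.
  by move=> vk; rewrite ltnNge; apply/negP => /Nv /(le_lt_trans vk); rewrite ltxx.
have [|n + nmax] := @seq_max_exists [seq k <- iota 0 N | k \notin A] k0.
  by rewrite mem_s k0A lt_N.
rewrite mem_s => /andP[nA nN]; exists n => // k kA.
have [vk|/ltW vk] := real_leP (ger0_real (v0 k0)) (ger0_real (v0 k)).
  by apply: nmax; rewrite mem_s kA lt_N.
by apply: le_trans vk _; apply: nmax; rewrite mem_s k0A lt_N.
Qed.

End GreedySets.

(** * Norming functionals *)

Section CountableHahnBanach.
Variables (K : numFieldType) (V : normedModType K) (z : nat -> V).
Hypothesis supK : real_sup_property K.
Implicit Types (l : seq (K * nat)) (c : nat -> K) (s : seq K).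

(** Combinations are kept formal, as lists of coefficients and indices, because the [z n] may be
    linearly dependent. Domination by the norm makes [val c l] depend on the vector [comb l]
    only. *)
Let comb l : V := \sum_(p <- l) p.1 *: z p.2.
Let val c l : K := \sum_(p <- l) p.1 * c p.2.
Let ok N l := all (fun p : K * nat => (p.1 \is Num.real) && (p.2 < N)%N) l.

Let dominated N c :=
  (forall n, (n < N)%N -> c n \is Num.real) /\
  (forall l, ok N l -> val c l <= `|comb l|).

Let scalel t l := [seq (t * p.1, p.2) | p <- l].

Let combZ t l : comb (scalel t l) = t *: comb l.
Proof.
by rewrite /comb big_map scaler_sumr; apply: eq_bigr => p _; rewrite scalerA.
Qed.

Let valZ c t l : val c (scalel t l) = t * val c l.
Proof. by rewrite /val big_map mulr_sumr; apply: eq_bigr => p _; rewrite mulrA. Qed.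

Let okZ N t l : t \is Num.real -> ok N l -> ok N (scalel t l).
Proof.
move=> tr /allP lN; apply/allP => _ /mapP[p pl ->] /=.
by have /andP[p1 ->] := lN _ pl; rewrite rpredM.
Qed.

Let val_real N c l : dominated N c -> ok N l -> val c l \is Num.real.
Proof.
move=> [cr _] /allP lN; rewrite /val big_seq; apply: rpred_sum => p /lN /andP[p1 p2].
by rewrite rpredM ?cr.
Qed.

Let eq_val N c c' l : (forall n, (n < N)%N -> c n = c' n) -> ok N l ->
  val c l = val c' l.
Proof.
move=> cc' /allP lN; rewrite /val big_seq [RHS]big_seq; apply: eq_bigr => p /lN.
by move=> /andP[_ /cc' ->].
Qed.

Let eq_dominated N c c' : (forall n, (n < N)%N -> c n = c' n) ->
  dominated N c -> dominated N c'.
Proof.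
move=> cc' [cr cd]; split=> [n nN|l lN]; first by rewrite -cc'// cr.
by rewrite -(eq_val cc' lN) cd.
Qed.

(** The one-dimensional Hahn-Banach extension. By the triangle inequality every
    [val c l - |comb l - z N|] lies below every [|comb l' + z N| - val c l'], and [g] is the
    supremum of the former. *)
Let dominated_step N c : dominated N c -> exists g, forall c',
  (forall n, (n < N)%N -> c n = c' n) -> c' N = g -> dominated N.+1 c'.
Proof.
move=> cd; have [cr cle] := cd.
have cross l l' : ok N l -> ok N l' ->
    val c l - `|comb l - z N| <= `|comb l' + z N| - val c l'.
  move=> lN l'N; rewrite lerBlDr addrAC lerBrDr -big_cat /=.
  apply: le_trans (cle (l ++ l') _) _; first by rewrite /ok all_cat; apply/andP.
  rewrite /comb big_cat /= -/(comb l) -/(comb l').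
  have -> : comb l + comb l' = (comb l' + z N) + (comb l - z N).
    by rewrite addrACA subrr addr0 addrC.
  exact: ler_normD.
have [||| g [g1 g2]] :=
    supK (E := [set val c l - `|comb l - z N| | l in [set l | ok N l]]).
- by eexists; exists [::].
- by move=> _ [l lN <-]; rewrite rpredB ?(val_real cd lN)// ger0_real.
- exists (`|comb [::] + z N| - val c [::]) => _ [l lN <-]; exact: cross.
have gr : g \is Num.real.
  have /ler_real <- : val c [::] - `|comb [::] - z N| <= g by apply: g1; exists [::].
  by rewrite rpredB ?(val_real cd)// ger0_real.
exists g => c' cc' c'N.
have c'd := eq_dominated cc' cd.
split=> [n|l lN].
  by rewrite ltnS leq_eqVlt => /predU1P[->|/c'd.1//]; rewrite c'N.
pose l0 := [seq p <- l | (p.2 < N)%N]; pose t := \sum_(p <- l | ~~ (p.2 < N)%N) p.1.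
have l0N : ok N l0.
  by apply/allP => p; rewrite mem_filter => /andP[-> /(allP lN)/andP[-> _]].
have idxN p : p \in l -> ~~ (p.2 < N)%N -> p.2 = N.
  by move=> /(allP lN)/andP[_]; rewrite ltnS -leqNgt => h1 h2; apply/eqP; rewrite eqn_leq h1.
have tr : t \is Num.real.
  by rewrite /t big_seq_cond; apply: rpred_sum => p /andP[/(allP lN)/andP[]].
have -> : comb l = comb l0 + t *: z N.
  rewrite /comb (bigID (fun p => p.2 < N)%N) /= big_filter scaler_suml; congr (_ + _).
  by rewrite big_seq_cond [RHS]big_seq_cond; apply: eq_bigr => p /andP[/idxN h /h ->].
have -> : val c' l = val c l0 + t * g.
  rewrite (eq_val cc' l0N) -c'N /val (bigID (fun p => p.2 < N)%N) /= big_filter mulr_suml.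
  congr (_ + _).
  by rewrite big_seq_cond [RHS]big_seq_cond; apply: eq_bigr => p /andP[/idxN h /h ->].
(* With [t] the total coefficient of [z N], the rest [l0] is divided by [|t|]: the upper bounds on
   [g] settle [t > 0], the lower bounds [t < 0]. *)
have [t0|t0|t0] := real_ltgtP tr (real0 K); last first.
- by rewrite t0 mul0r scale0r !addr0 cle.
- have : g <= `|comb (scalel t^-1 l0) + z N| - val c (scalel t^-1 l0).
    by apply: g2 => _ [l1 l1N <-]; apply: cross; rewrite // okZ// rpredV.
  rewrite combZ valZ -(ler_pM2l t0) mulrBr mulrA divff ?gt_eqF// mul1r.
  rewrite -{2}(gtr0_norm t0) -normrZ scalerDr scalerA divff ?gt_eqF// scale1r.
  by rewrite lerBrDr addrC.
have nt0 : 0 < - t by rewrite oppr_gt0.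
have : val c (scalel (- t)^-1 l0) - `|comb (scalel (- t)^-1 l0) - z N| <= g.
  by apply: g1; eexists => //=; rewrite okZ// rpredV rpredN.
rewrite combZ valZ -(ler_pM2l nt0) mulrBr mulrA divff ?gt_eqF// mul1r.
rewrite -{1}(gtr0_norm nt0) -normrZ scalerBr scalerA divff ?gt_eqF// scale1r.
by rewrite scaleNr opprK mulNr lerBlDr [leRHS]addrC lerBrDr.
Qed.

Lemma countable_hahn_banach : exists c : nat -> K,
  [/\ forall n, c n \is Num.real, c 0%N = `|z 0%N| &
      forall l, all (fun p : K * nat => p.1 \is Num.real) l ->
        \sum_(p <- l) p.1 * c p.2 <= `|\sum_(p <- l) p.1 *: z p.2|].
Proof.
(* The next value is chosen for all finite lists at once, with default 0 on lists that are not
   dominated; iterating [f] then replaces dependent choice. *)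
have /choice[f f_ext] : forall s, exists g,
    dominated (size s) (nth 0 s) -> dominated (size s).+1 (nth 0 (rcons s g)).
  move=> s; have [d|nd] := pselect (dominated (size s) (nth 0 s)); last by exists 0.
  have [g gP] := dominated_step d; exists g => _; apply: gP => [n ns|].
    by rewrite nth_rcons ns.
  by rewrite nth_rcons ltnn eqxx.
pose S n := iter n (fun s => rcons s (f s)) [:: `|z 0%N|].
have size_S n : size (S n) = n.+1 by elim: n => //= n IH; rewrite size_rcons IH.
have S_dom n : dominated n.+1 (nth 0 (S n)).
  elim: n => [|n IH] /=; last by rewrite -(size_S n); apply: f_ext; rewrite size_S.
  split=> [[|//] _ /=|l lN]; first exact: ger0_real.
  have l0 p : p \in l -> p.2 = 0%N.
    by move=> /(allP lN)/andP[_]; rewrite ltnS leqn0 => /eqP.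
  have tr : \sum_(p <- l) p.1 \is Num.real.
    by rewrite big_seq; apply: rpred_sum => p /(allP lN)/andP[].
  have -> : comb l = (\sum_(p <- l) p.1) *: z 0%N.
    by rewrite scaler_suml /comb big_seq [RHS]big_seq; apply: eq_bigr => p /l0 ->.
  have -> : val (nth 0 (S 0%N)) l = (\sum_(p <- l) p.1) * `|z 0%N|.
    by rewrite mulr_suml /val big_seq [RHS]big_seq; apply: eq_bigr => p /l0 ->.
  by rewrite normrZ ler_wpM2r// real_ler_norm.
pose c n := nth 0 (S n) n.
have S_c n m : (n < m.+1)%N -> nth 0 (S m) n = c n.
  elim: m => [|m IH]; first by case: n.
  rewrite ltnS leq_eqVlt => /predU1P[->//|nm] /=.
  by rewrite nth_rcons size_S nm IH.
exists c; split=> // [n|l lr].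
  by have [cr _] := S_dom n; apply: cr.
pose N := \max_(p <- l) p.2.
have lN : ok N.+1 l.
  apply/allP => p pl; rewrite (allP lr)//= ltnS.
  exact: (@leq_bigmax_seq _ _ xpredT (fun p : K * nat => p.2)).
have [_ cd] := eq_dominated (fun n => @S_c n N) (S_dom N).
exact: cd.
Qed.

End CountableHahnBanach.

(* b is the complexification of a real functional c norming g on the real span
   of g, the x n and the I x n; the factor 2 is the price of bounding its real
   and imaginary parts separately. *)
Lemma norming_coefficients (K : numFieldType) (I : K) (V : normedModType K)
    (x : nat -> V) (A : {fset nat}) (al : nat -> K) :
  imaginary_unit I -> real_sup_property K ->
  exists b : nat -> K,
    (forall (D : {fset nat}) (a : nat -> K),
      `|\sum_(n <- D) a n * b n| <= 2 * `|\sum_(n <- D) a n *: x n|) /\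
    `|\sum_(n <- A) al n *: x n| <= `|\sum_(n <- A) al n * b n|.
Proof.
move=> [I1 dec normI] supK.
set g := \sum_(n <- A) al n *: x n.
(* Index 0 carries [g], index 2n+1 carries [x n] and index 2n+2 carries [I *: x n], so that [c1] and
   [c2] are the values of the functional at [x n] and [I *: x n]. *)
pose z k := if k is j.+1 then (if odd j then I *: x j./2 else x j./2) else g.
have [c [c_real c0 c_le]] := countable_hahn_banach z supK.
pose c1 n := c n.*2.+1; pose c2 n := c n.*2.+2.
pose U D (r s : nat -> K) := \sum_(n <- D) (r n * c1 n + s n * c2 n).
have U_le (D : {fset nat}) (r s : nat -> K) t : t \is Num.real ->
    (forall n, r n \is Num.real) -> (forall n, s n \is Num.real) ->
    t * `|g| + U D r s <= `|t *: g + \sum_(n <- D) (r n + I * s n) *: x n|.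
  move=> tr rr sr; pose l := (t, 0%N) :: [seq (r n, n.*2.+1) | n <- D]
    ++ [seq (s n, n.*2.+2) | n <- D].
  have := c_le l; rewrite /= tr all_cat !all_map /=.
  have -> : all (preim (fun n => (r n, n.*2.+1)) (fun p : K * nat => p.1 \is Num.real)) D.
    by apply/allP => n _ /=.
  have -> : all (preim (fun n => (s n, n.*2.+2)) (fun p : K * nat => p.1 \is Num.real)) D.
    by apply/allP => n _ /=.
  move=> /(_ isT); rewrite /l !big_cons !big_cat !big_map /= c0 -!big_split /=.
  congr (_ <= `|_ + _|); apply: eq_bigr => n _.
  by rewrite /z /= odd_double uphalf_double doubleK /= scalerDl (mulrC I) scalerA.
have U_real (D : {fset nat}) (r s : nat -> K) :
    (forall n, r n \is Num.real) -> (forall n, s n \is Num.real) ->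
    U D r s \is Num.real.
  move=> rr sr; apply: rpred_sum => n _.
  by rewrite rpredD ?rpredM ?c_real.
have U_abs (D : {fset nat}) (r s : nat -> K) :
    (forall n, r n \is Num.real) -> (forall n, s n \is Num.real) ->
    `|U D r s| <= `|\sum_(n <- D) (r n + I * s n) *: x n|.
  move=> rr sr; rewrite real_ler_norml ?U_real//.
  have := U_le D r s 0 (real0 K) rr sr.
  rewrite mul0r scale0r !add0r => ->; rewrite andbT lerNl.
  have := U_le D (fun n => - r n) (fun n => - s n) 0 (real0 K).
  rewrite mul0r scale0r !add0r => H.
  apply: le_trans (le_trans (H _ _) _).
  - rewrite /U -sumrN le_eqVlt; apply/orP; left; apply/eqP.
    by apply: eq_bigr => n _; rewrite !mulNr opprD.
  - by move=> n; rewrite rpredN.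
  - by move=> n; rewrite rpredN.
  rewrite -normrN -sumrN le_eqVlt; apply/orP; left; apply/eqP; congr `|_|.
  by apply: eq_bigr => n _; rewrite -scaleNr opprD !opprK mulrN opprK.
have /choice[r /choice[s rs]] := dec.
have rr a : r a \is Num.real by have [] := rs a.
have sr a : s a \is Num.real by have [] := rs a.
(* Multiplication by [I] turns the coefficient pair [(r, s)] into [(- s, r)], so the second term is
   [- I * u (I f)], where [u] is the real functional. *)
have sumE (D : {fset nat}) (a : nat -> K) :
    \sum_(n <- D) a n * (c1 n - I * c2 n) =
    U D (r \o a) (s \o a) + I * U D (s \o a) (fun n => - r (a n)).
  rewrite mulr_sumr -big_split; apply: eq_bigr => n _ /=.
  have [_ _ e Is] := rs (a n); rewrite [in LHS]e.
  have -> : (r (a n) + I * s (a n)) * (c1 n - I * c2 n) =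
    r (a n) * c1 n - I * (I * s (a n)) * c2 n
    + I * (s (a n) * c1 n - r (a n) * c2 n) by ring.
  by rewrite Is mulNr opprK mulNr.
exists (fun n => c1 n - I * c2 n); split=> [D a|].
  rewrite sumE mulr_natl; apply: le_trans (ler_normD _ _) _.
  rewrite [leRHS]mulr2n; apply: lerD.
    apply: le_trans (U_abs _ _ _ _ _) _ => //=.
    by under eq_bigr => n _ do [have [_ _ <- _] := rs (a n)].
  rewrite normrM -[leRHS]mul1r ler_pM//.
  apply: le_trans (U_abs _ _ _ _ _) _ => //= [n|]; first by rewrite rpredN.
  have -> : \sum_(n <- D) (s (a n) + I * - r (a n)) *: x n =
      - I *: \sum_(n <- D) a n *: x n.
    rewrite scaler_sumr; apply: eq_bigr => n _; rewrite scalerA.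
    have [_ _ e Is] := rs (a n); rewrite {3}e mulNr mulrDr Is.
    by rewrite opprD opprK mulrN addrC.
  by rewrite normrZ normrN -[leRHS]mul1r ler_wpM2r.
rewrite sumE.
have nr n : - r (al n) \is Num.real by rewrite rpredN.
have [+ _] := normI (U A (r \o al) (s \o al)) (U A (s \o al) (fun n => - r (al n)))
  (U_real _ _ _ (fun=> rr _) (fun=> sr _)) (U_real _ _ _ (fun=> sr _) nr).
apply: le_trans.
apply: le_trans (real_ler_norm (U_real _ _ _ (fun=> rr _) (fun=> sr _))).
(* Domination is tested on [g] minus its own expansion, which is 0: this bounds [|g|] by the real
   part of the sum. *)
have := U_le A (fun n => - r (al n)) (fun n => - s (al n)) 1 (real1 K) nr.
have ns n : - s (al n) \is Num.real by rewrite rpredN.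
move=> /(_ ns); rewrite mul1r scale1r.
have -> : U A (fun n => - r (al n)) (fun n => - s (al n)) = - U A (r \o al) (s \o al).
  by rewrite /U -sumrN; apply: eq_bigr => n _; rewrite !mulNr opprD.
have -> : \sum_(n <- A) (- r (al n) + I * - s (al n)) *: x n = - g.
  rewrite -sumrN; apply: eq_bigr => n _.
  have [_ _ e _] := rs (al n).
  by rewrite mulrN -opprD -e scaleNr.
by rewrite subrr normr0 subr_le0.
Qed.

(** * The Banach envelope *)

Section ClosedSubspace.
Variables (K : numFieldType) (V : completeNormedModType K) (P : V -> Prop).
Hypothesis P_linear : forall a u v, P u -> P v -> P (a *: u + v).
Hypothesis P0 : P 0.
Hypothesis P_closed :
  forall y, (forall e : K, 0 < e -> exists2 z, P z & `|y - z| < e) -> P y.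

Let mem_P : {pred V} := fun y => `[< P y >].

Let mem_P_closed : GRing.submod_closed mem_P.
Proof.
split; first exact/asboolP.
by move=> a u v /asboolP Pu /asboolP Pv; apply/asboolP; exact: P_linear.
Qed.

HB.instance Definition _ := GRing.isSubmodClosed.Build K V mem_P
  (GRing.submod_closed_semi mem_P_closed).

(** A closed subspace becomes a type of its own, because the universal property of the envelope
    quantifies over Banach spaces given as types. *)
Record subspace := Subspace { subspace_val : V; _ : subspace_val \in mem_P }.

HB.instance Definition _ := [isSub for subspace_val].
HB.instance Definition _ := [Choice of subspace by <:].
HB.instance Definition _ := [SubChoice_isSubLmodule of subspace by <:].

Let norm (u : subspace) : K := `|val u|.

Let norm_le u v : norm (u + v) <= norm u + norm v.
Proof. exact: ler_normD. Qed.

Let normZ a u : norm (a *: u) = `|a| * norm u.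
Proof. by rewrite /norm linearZ normrZ. Qed.

Let norm_eq0 u : norm u = 0 -> u = 0.
Proof. by move=> /eqP; rewrite normr_eq0 => /eqP u0; apply: val_inj; rewrite u0 raddf0. Qed.

HB.instance Definition _ := Lmodule_isNormed.Build K subspace norm_le normZ norm_eq0.

Let subspace_complete (F : set_system subspace) :
  ProperFilter F -> cauchy F -> cvg F.
Proof.
move=> FF /cauchyP Fc.
have : cvg (val @ F).
  apply: cauchy_cvg; apply/cauchyP => e e0; have [u Fu] := Fc e e0.
  exists (val u); rewrite /fmap /=.
  by apply: (filterS _ Fu) => v; rewrite /preimage -!ball_normE.
move=> /cvg_ex[/= l Fl]; have Pl : P l.
  apply: P_closed => e e0; move/cvgrPdist_lt : Fl => /(_ e e0) Fl.
  have [u lu] := filter_ex Fl.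
  by exists (val u) => //; apply/asboolP; exact: valP u.
have lP : l \in mem_P by apply/asboolP.
apply/cvg_ex; exists (Subspace lP); apply/cvgrPdist_lt => e e0.
by move/cvgrPdist_lt : Fl => /(_ e e0).
Qed.

HB.instance Definition _ := Uniform_isComplete.Build subspace subspace_complete.

Lemma closed_subspace_banach : exists (Z : completeNormedModType K)
    (i : {linear Z -> V}),
  [/\ forall z, `|i z| = `|z|, forall z, P (i z) &
      forall y, P y -> exists z, i z = y].
Proof.
exists subspace, (GRing.Linear.clone _ _ _ _ (\val : subspace -> V) _); split=> //.
  by move=> z; apply/asboolP; exact: valP z.
move=> y Py; have yP : y \in mem_P by apply/asboolP.
by exists (Subspace yP).
Qed.

End ClosedSubspace.

(** * Operator norms with respect to a quasi-norm *)

Section OperatorNorm.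
Variables (K : numFieldType) (V : lmodType K) (q : V -> K) (W : Type) (NW : W -> K).
Hypotheses (supK : real_sup_property K) (q_norm : quasi_norm q).
Hypothesis NW0 : forall w, 0 <= NW w.

Lemma quasi_norm_ge0 f : 0 <= q f. Proof. by case: q_norm. Qed.

Lemma quasi_norm0 : q 0 = 0.
Proof. by case: q_norm => _ _ qZ _; rewrite -(scale0r 0) qZ normr0 mul0r. Qed.

(** [op_bounded] does not say that its constant is nonnegative; its modulus is, and serves as well
    because [C * q f] is nonnegative. *)
Lemma op_bound_abs (T : V -> W) (C : K) f : NW (T f) <= C * q f ->
  NW (T f) <= `|C| * q f.
Proof.
move=> TC; have := le_trans (NW0 _) TC => Cq0.
by rewrite -(ger0_norm (quasi_norm_ge0 f)) -normrM (ger0_norm Cq0).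
Qed.

(** The set is nonempty, as it contains the value at 0, and bounded; so [supremum] returns a least
    upper bound and not its default. *)
Lemma op_norm_supremums (T : V -> W) : op_bounded q NW T ->
  supremums [set NW (T f) | f in [set f | q f <= 1]] (op_norm q NW T).
Proof.
move=> [C TC]; rewrite /op_norm /supremum; case: ifPn => [/eqP|_].
  move=> /eqP/negPn/negP[]; apply/set0P; exists (NW (T 0)), 0 => //=.
  by rewrite quasi_norm0.
apply: xgetPex; apply: supK.
- by exists (NW (T 0)), 0 => //=; rewrite quasi_norm0.
- by move=> _ [f _ <-]; rewrite ger0_real.
- exists `|C| => _ [f /= f1 <-]; apply: le_trans (op_bound_abs (TC f)) _.
  by rewrite -[leRHS]mulr1 ler_wpM2l.
Qed.

Lemma op_norm_ge0 (T : V -> W) : op_bounded q NW T -> 0 <= op_norm q NW T.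
Proof.
move=> /op_norm_supremums[+ _]; move=> /(_ (NW (T 0))) H.
by apply: le_trans (H _); [exact: NW0|exists 0 => //=; rewrite quasi_norm0].
Qed.

Lemma op_norm_le (T : V -> W) (C : K) : 0 <= C ->
  (forall f, NW (T f) <= C * q f) -> op_norm q NW T <= C.
Proof.
move=> C0 TC; have [_ +] := op_norm_supremums (ex_intro _ C TC); apply.
move=> _ [f /= f1 <-]; apply: le_trans (TC f) _.
by rewrite -[leRHS]mulr1 ler_wpM2l.
Qed.

Lemma le_op_norm (T : V -> W) f : op_bounded q NW T ->
  (forall a g, NW (T (a *: g)) = `|a| * NW (T g)) ->
  NW (T f) <= op_norm q NW T * q f.
Proof.
move=> Tb TZ; have [qf0|qf_neq0] := eqVneq (q f) 0.
  have [C TC] := Tb; have := TC f; rewrite qf0 !mulr0.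
  exact: le_trans.
have [+ _] := op_norm_supremums Tb.
have q_gt0 : 0 < q f by rewrite lt_def qf_neq0 quasi_norm_ge0.
move=> /(_ (NW (T ((q f)^-1 *: f)))) H.
rewrite -ler_pdivrMr//; apply: le_trans (H _).
  by rewrite TZ normfV gtr0_norm// mulrC.
exists ((q f)^-1 *: f) => //=; case: q_norm => _ _ -> _.
by rewrite normfV gtr0_norm// mulVf.
Qed.

End OperatorNorm.

Lemma quasi_norm_norm (K : numFieldType) (V : normedModType K) :
  quasi_norm (fun y : V => `|y|).
Proof.
split=> //; [exact: normr0_eq0|exact: normrZ|].
by exists 1 => // f g; rewrite mul1r; exact: ler_normD.
Qed.

Section BanachScalarMaps.
Variables (K : numFieldType) (hK : real_or_complex K) (V : lmodType K).

(** Scalar forms and linear maps into [banach_scalars hK] are the same functions at different types;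
    the two conversions let the universal property act on functionals. *)
Definition scalar_to_banach (T : {scalar V}) : V -> banach_scalars hK := T.

Lemma scalar_to_banach_linear T : linear (scalar_to_banach T).
Proof. by move=> a u v; rewrite /scalar_to_banach linearP. Qed.

HB.instance Definition _ T :=
  GRing.isLinear.Build K V (banach_scalars hK) *:%R (scalar_to_banach T)
    (@scalar_to_banach_linear T).

Definition banach_to_scalar (S : {linear V -> banach_scalars hK}) : V -> K := S.

Lemma banach_to_scalar_scalar S : scalar (banach_to_scalar S).
Proof. by move=> a u v; rewrite /banach_to_scalar linearP. Qed.

HB.instance Definition _ S :=
  GRing.isLinear.Build K V K *%R (banach_to_scalar S)
    (@banach_to_scalar_scalar S).

End BanachScalarMaps.

Section Envelope.
Variables (K : numFieldType) (hK : real_or_complex K) (X : lmodType K) (q : X -> K).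
Hypothesis q_norm : quasi_norm q.
Variables (Xc : completeNormedModType K) (J : {linear X -> Xc}).
Hypothesis hJ : is_banach_envelope q J.

Let normXc := fun y : Xc => `|y|.
Let supK := real_or_complex_sup hK.

Lemma envelope_bounded : exists2 C : K, 0 <= C & forall f, `|J f| <= C * q f.
Proof.
case: hJ => -[C JC] _ _; exists `|C| => // f.
exact: (op_bound_abs q_norm (fun y : Xc => normr_ge0 y) (JC f)).
Qed.

(** The universal property with the scalar field as target; its norm clause preserves the constant
    [C]. *)
Lemma envelope_extend_scalar (T : {scalar X}) (C : K) : 0 <= C ->
  (forall f, `|T f| <= C * q f) ->
  exists S : {scalar Xc},
    (forall f, S (J f) = T f) /\ forall y, `|S y| <= C * `|y|.
Proof.
move=> C0 TC; case: hJ => _ _ /(_ (banach_scalars hK) (scalar_to_banach hK T)).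
case; first by exists C.
move=> S [Sb SJ S_le _]; exists (banach_to_scalar S); split; first exact: SJ.
move=> y; apply: le_trans (le_op_norm supK (quasi_norm_norm Xc) _ y Sb _) _ => //.
  by move=> a g; rewrite linearZ normrZ.
apply: ler_wpM2r => //; apply: le_trans S_le _.
by apply: (op_norm_le supK q_norm) => // w; exact: normr_ge0.
Qed.

Lemma envelope_scalar_unique (S S' : {scalar Xc}) (C C' : K) :
  (forall y, `|S y| <= C * `|y|) -> (forall y, `|S' y| <= C' * `|y|) ->
  (forall f, S (J f) = S' (J f)) -> S =1 S'.
Proof.
move=> SC SC' SS'; have [CJ CJ0 JC] := envelope_bounded.
case: hJ => _ _ /(_ (banach_scalars hK) (scalar_to_banach hK S \o J)).
case.
  exists (`|C| * CJ) => f /=.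
  have := op_bound_abs (quasi_norm_norm Xc) (fun a => normr_ge0 a) (SC (J f)).
  by move=> /le_trans; apply; rewrite -mulrA ler_wpM2l.
move=> S0 [_ _ _ S0u] y.
have e1 := S0u (scalar_to_banach hK S) (ex_intro _ C SC) (fun=> erefl) y.
have e2 := S0u (scalar_to_banach hK S') (ex_intro _ C' SC') (fun f => esym (SS' f)) y.
exact: etrans e1 (esym e2).
Qed.

Let in_closure (y : Xc) := forall e : K, 0 < e -> exists f, `|y - J f| < e.

(* J factors through the closure Z of its range; by uniqueness the resulting
   map Xc -> Z -> Xc is the identity, so that Z is all of Xc. *)
Lemma envelope_dense (y : Xc) (e : K) : 0 < e -> exists f, `|y - J f| < e.
Proof.
have Jcl f : in_closure (J f).
  by move=> d d0; exists f; rewrite subrr normr0.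
have [||| Z [i [iN iZ Zi]]] := @closed_subspace_banach K Xc in_closure.
- move=> a u v uc vc d d0.
  (* Adding 1 keeps the divisor positive when [a] is 0. *)
  have a0 : 0 < `|a| + 1 by rewrite ltr_wpDl.
  have [|f uf] := uc (d / 2 / (`|a| + 1)); first by rewrite !divr_gt0.
  have [|g vg] := vc (d / 2); first by rewrite divr_gt0.
  exists (a *: f + g); rewrite linearP opprD addrACA -scalerBr.
  apply: le_lt_trans (ler_normD _ _) _; rewrite [ltRHS]splitr.
  apply: ler_ltD => //; rewrite normrZ.
  apply: le_trans (_ : (`|a| + 1) * (d / 2 / (`|a| + 1)) <= _); last first.
    by rewrite mulrC divfK// gt_eqF.
  by apply: ler_pM => //; [rewrite lerDl|exact: ltW].
- by move=> d d0; exists 0; rewrite linear0 subrr normr0.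
- move=> u ucl d d0; have d2 : 0 < d / 2 by rewrite divr_gt0.
  have [z zc uz] := ucl _ d2; have [f zf] := zc _ d2.
  exists f; rewrite -(subrKA z) [ltRHS]splitr.
  by apply: le_lt_trans (ler_normD _ _) _; rewrite ltrD.
have /choice[k kJ] : forall f, exists z, i z = J f by move=> f; exact: Zi.
have i_inj : injective i.
  move=> u v uv; apply/eqP; rewrite -subr_eq0 -normr_eq0 -iN linearB uv subrr.
  by rewrite normr0.
have k_lin : linear k by move=> a u v; apply: i_inj; rewrite kJ !linearP !kJ.
pose kL := GRing.isLinear.Build K X Z *:%R k k_lin.
pose k' : {linear X -> Z} := HB.pack k kL.
have [CJ CJ0 JC] := envelope_bounded.
case: hJ => _ _ univ.
have [|S [[CS SC] SJ _ _]] := univ Z k'.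
  by exists CJ => f; rewrite /= -iN kJ.
have [|T0 [_ _ _ T0u]] := univ Xc J; first by exists CJ.
have iS : i (S y) = y.
  have iSb : op_bounded normXc normXc (i \o S) by exists CS => w /=; rewrite /normXc iN.
  have idb : op_bounded normXc normXc (idfun : {linear Xc -> Xc}).
    by exists 1 => w; rewrite mul1r.
  have iSJ f : (i \o S) (J f) = J f by rewrite /= SJ; exact: kJ.
  have e1 := T0u _ iSb iSJ y; have e2 := T0u _ idb (fun=> erefl) y.
  exact: etrans e1 (esym e2).
by have := iZ (S y); rewrite iS; apply.
Qed.

End Envelope.

(** * Bidemocratic quasi-greedy bases *)

Lemma scalar_sum_exists (K : numFieldType) (V : lmodType K) (phi : nat -> {scalar V})
    (D : {fset nat}) (b : nat -> K) :
  exists T : {scalar V}, forall f, T f = \sum_(n <- D) b n * phi n f.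
Proof.
pose T f := \sum_(n <- D) b n * phi n f.
have T_lin : scalar T.
  move=> a u v; rewrite /T mulr_sumr -big_split; apply: eq_bigr => n _ /=.
  by rewrite linearP mulrDr mulrCA.
pose TL := GRing.isLinear.Build K V K *%R T T_lin.
by exists (HB.pack T TL : {scalar V}).
Qed.

Section BidemocraticBasis.
Variables (K : numFieldType) (hK : real_or_complex K) (X : lmodType K) (q : X -> K).
Hypothesis q_norm : quasi_norm q.
Variables (x : nat -> X) (xs : nat -> {scalar X}).
Hypotheses (bidem : bidemocratic_basis q x xs) (qgreedy : quasi_greedy_basis q x xs).
Variables (Xc : completeNormedModType K) (J : {linear X -> Xc}).
Hypothesis hJ : is_banach_envelope q J.

Let normXc := fun y : Xc => `|y|.
Let supK := real_or_complex_sup hK.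
Let q_ge0 f : 0 <= q f := quasi_norm_ge0 q_norm f.

Let dual_ge0 (phi : X -> K) : op_bounded q (fun a : K => `|a|) phi ->
  0 <= dual_norm q phi.
Proof. by move=> b; apply: (op_norm_ge0 supK q_norm) => // a; exact: normr_ge0. Qed.

Let dual_le (T : {scalar X}) f : op_bounded q (fun a : K => `|a|) T ->
  `|T f| <= dual_norm q T * q f.
Proof.
move=> b; apply: (le_op_norm supK q_norm) b _ => [a|a g]; first exact: normr_ge0.
by rewrite linearZ normrM.
Qed.

Let xs_bounded n : op_bounded q (fun a : K => `|a|) (xs n).
Proof. by case: qgreedy => -[_ + _] _ _ _; exact. Qed.

Lemma coordinate_sum_bounded (D : {fset nat}) (b : nat -> K) :
  op_bounded q (fun a : K => `|a|) (fun f => \sum_(n <- D) b n * xs n f).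
Proof.
exists (\sum_(n <- D) `|b n| * dual_norm q (xs n)) => f; rewrite mulr_suml.
apply: le_trans (ler_norm_sum _ _ _) _; apply: ler_sum => n _.
by rewrite normrM -mulrA ler_wpM2l// dual_le.
Qed.

Lemma semi_normalized_bounds : exists c C : K,
  [/\ 0 < c, 0 <= C, forall n, c <= q (x n) & forall n, q (x n) <= C].
Proof.
case: qgreedy => _ _ [c [C [c0 cC]]] _; exists c, C; split=> // [|n|n].
- by have [_ ] := cC 0%N; apply: le_trans.
- by have [] := cC n.
- by have [] := cC n.
Qed.

(** The bound on [q (x n) * dual_norm q (xs n)] is divided by the lower bound on [q (x n)]. *)
Lemma coordinate_dual_norm_bound : exists2 L : K, 0 <= L &
  forall n, dual_norm q (xs n) <= L.
Proof.
have [c [_ [c0 _ cx _]]] := semi_normalized_bounds.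
case: qgreedy => _ [M Mb] _ _.
have le n : dual_norm q (xs n) <= M / c.
  rewrite ler_pdivlMr// mulrC; apply: le_trans (Mb n).
  by apply: ler_wpM2r; [exact: dual_ge0|exact: cx].
by exists (M / c) => //; apply: le_trans (le 0%N); exact: dual_ge0.
Qed.

(** Up to a small error, [f] is a finite combination of basis vectors, whose late coordinates
    vanish; the coordinate functionals are uniformly bounded. This gives exact greedy sets of every
    size in [X]. *)
Lemma coordinates_null f e : 0 < e ->
  exists N, forall n, (N <= n)%N -> `|xs n f| < e.
Proof.
move=> e0; have [L L0 Ln] := coordinate_dual_norm_bound.
case: qgreedy => -[dense _ biorth] _ _ _.
have L1 : 0 < L + 1 by rewrite ltr_wpDl.
have [|N [c Nc]] := dense f (e / (L + 1)); first by rewrite divr_gt0.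
exists N => n Nn; set h := f - _ in Nc.
have -> : xs n f = xs n h.
  rewrite /h linearB linear_sum big1 ?subr0// => i _.
  rewrite linearZ /= biorth (_ : (i == n :> nat) = false) ?mulr0//.
  by apply/negbTE; rewrite neq_ltn (leq_trans (ltn_ord i) Nn).
apply: le_lt_trans (dual_le _ (xs_bounded n)) _.
apply: (@le_lt_trans _ _ ((L + 1) * q h)).
  by apply: ler_wpM2r => //; apply: le_trans (Ln n) _; rewrite lerDl.
by rewrite mulrC -ltr_pdivlMr.
Qed.

Lemma greedy_set_exists f m : exists2 A : {fset nat}, #|` A| = m & greedy_set xs A f.
Proof.
have [A|A Am Agr] := @greedy_fset_exists K (fun n => `|xs n f|) 1 m (lexx 1).
  have [n nA nmax] := null_seq_max (fun n => normr_ge0 (xs n f)) (@coordinates_null f) A.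
  by exists n => // k kA; rewrite mul1r nmax.
by exists A => // n k nA kA; rewrite -[leRHS]mul1r Agr.
Qed.

Lemma dual_basis_exists : exists ys : nat -> {scalar Xc}, forall n,
  (forall f, ys n (J f) = xs n f) /\
  forall y, `|ys n y| <= dual_norm q (xs n) * `|y|.
Proof.
have /choice[ys ysP] : forall n, exists S : {scalar Xc},
    (forall f, S (J f) = xs n f) /\ forall y, `|S y| <= dual_norm q (xs n) * `|y|.
  move=> n; apply: (envelope_extend_scalar hK q_norm hJ); first exact: dual_ge0.
  by move=> f; exact: dual_le.
by exists ys.
Qed.

Variable ys : nat -> {scalar Xc}.
Hypothesis ysJ : forall n f, ys n (J f) = xs n f.
Hypothesis ys_le : forall n y, `|ys n y| <= dual_norm q (xs n) * `|y|.

(** The combination of the [ys n] is the only bounded extension of that of the [xs n], so it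
    inherits the bound of the extension given by the universal property. *)
Lemma coordinate_sum_extends (D : {fset nat}) (b : nat -> K) (C : K) : 0 <= C ->
  (forall f, `|\sum_(n <- D) b n * xs n f| <= C * q f) ->
  forall y, `|\sum_(n <- D) b n * ys n y| <= C * `|y|.
Proof.
move=> C0 TC y.
have [T TE] := scalar_sum_exists xs D b; have [S SE] := scalar_sum_exists ys D b.
have [|S' [S'J S'C]] := envelope_extend_scalar hK q_norm hJ (T := T) C0.
  by move=> f; rewrite TE.
have SC u : `|S u| <= (\sum_(n <- D) `|b n| * dual_norm q (xs n)) * `|u|.
  rewrite SE mulr_suml; apply: le_trans (ler_norm_sum _ _ _) _.
  by apply: ler_sum => n _; rewrite normrM -mulrA ler_wpM2l.
rewrite -SE (envelope_scalar_unique hK q_norm hJ SC S'C) // => f.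
by rewrite S'J SE TE; apply: eq_bigr => n _; rewrite ysJ.
Qed.

(** Boundedness of [J] controls the sums of the [J (x n)], and extension to the envelope controls
    those of the [ys n]. The exchange takes place once over [X] and once over [Xc], hence the two
    forms. *)
Lemma envelope_bidemocratic : exists2 C : K, 0 <= C &
  forall m (D E : {fset nat}), (#|` D| <= m)%N -> (#|` E| <= m)%N ->
    (forall f, `|\sum_(n <- D) J (x n)| * `|\sum_(n <- E) xs n f|
       <= C * q f * m%:R) /\
    (forall y, `|\sum_(n <- D) J (x n)| * `|\sum_(n <- E) ys n y|
       <= C * `|y| * m%:R).
Proof.
have [CJ CJ0 JC] := envelope_bounded q_norm hJ.
case: bidem => _ [C Cb]; exists (CJ * `|C|); first by rewrite mulr_ge0.
move=> m D E Dm Em.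
set d := dual_norm q (fun f => \sum_(n <- E) xs n f).
have Eb : op_bounded q (fun a : K => `|a|) (fun f => \sum_(n <- E) xs n f).
  have [B Bb] := coordinate_sum_bounded E (fun=> 1); exists B => f.
  by under eq_bigr => n _ do rewrite -[xs n f]mul1r; exact: Bb.
have d0 : 0 <= d by exact: dual_ge0.
have dX f : `|\sum_(n <- E) xs n f| <= d * q f.
  apply: (le_op_norm supK q_norm) Eb _ => [a|a g]; first exact: normr_ge0.
  by under eq_bigr => n _ do rewrite linearZ /=; rewrite -mulr_sumr normrM.
have dXc y : `|\sum_(n <- E) ys n y| <= d * `|y|.
  under eq_bigr => n _ do rewrite -[ys n y]mul1r.
  apply: (@coordinate_sum_extends E (fun=> 1)) => // f.
  by under eq_bigr => n _ do rewrite mul1r; exact: dX.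
have Dd : `|\sum_(n <- D) J (x n)| * d <= CJ * `|C| * m%:R.
  rewrite -linear_sum; apply: le_trans (_ : CJ * (q (\sum_(n <- D) x n) * d) <= _).
    by rewrite mulrA ler_wpM2r.
  rewrite -mulrA ler_wpM2l//.
  have := Cb m D E; rewrite geq_max Dm Em => /(_ isT) CbDE.
  have := le_trans (mulr_ge0 (q_ge0 _) d0) CbDE => Cm0.
  by apply: le_trans CbDE _; rewrite -(ger0_norm Cm0) normrM normr_nat.
have lift (a t : K) : 0 <= t -> a <= d * t ->
    `|\sum_(n <- D) J (x n)| * a <= CJ * `|C| * t * m%:R.
  move=> t0 at_; apply: le_trans (ler_wpM2l (normr_ge0 _) at_) _.
  by rewrite mulrA [leRHS]mulrAC ler_wpM2r.
by split=> [f|y]; apply: lift.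
Qed.

(* A functional F on the span of the J (x n), given by its coefficients b: its
   projection on a weakly greedy set is compared, at f, with its value at the
   projection of f on a greedy set of f. *)
Lemma dual_quasi_greedy : exists2 C : K, 0 <= C &
  forall (b : nat -> K) (A : {fset nat}),
    (forall (D : {fset nat}) (a : nat -> K),
      `|\sum_(n <- D) a n * b n| <= 2 * `|\sum_(n <- D) a n *: J (x n)|) ->
    (forall n k, n \in A -> k \notin A -> `|b k| <= 2 * `|b n|) ->
    forall y, `|\sum_(n <- A) b n * ys n y| <= C * `|y|.
Proof.
have [CJ CJ0 JC] := envelope_bounded q_norm hJ.
have [Cb Cb0 bi] := envelope_bidemocratic.
have [I hI] := real_or_complex_imaginary_unit hK.
case: qgreedy => _ _ _ [Cq qg].
(* The first term bounds the functional at the greedy projection of [f]; the second is the exchange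
   error for [lam = 2] and [M = 2 * Cb * q f]. *)
exists (2 * (CJ * `|Cq|) + 32 * (2 * (2 * Cb))).
  by rewrite addr_ge0 ?mulr_ge0.
move=> b A bF bA; apply: coordinate_sum_extends.
  by rewrite addr_ge0 ?mulr_ge0.
move=> f; have [B BA Bgr] := greedy_set_exists f #|` A|.
have b_sum (D : {fset nat}) : `|\sum_(n <- D) b n| <= 2 * `|\sum_(n <- D) J (x n)|.
  have := bF D (fun=> 1); under eq_bigr do rewrite mul1r.
  by under [in leRHS]eq_bigr do rewrite scale1r.
have := @norm_greedy_swap K I hI nat A B b (fun n => xs n f) (2 * Cb * q f) 2.
move=> /(_ _ (esym BA) bA _ _)/le_trans; apply.
- by rewrite ler1n.
- move=> n k nB kB; apply: le_trans (Bgr n k nB kB) _.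
  by rewrite -[leLHS]mul1r ler_wpM2r// ler1n.
- move=> m D E Dm Em; have [+ _] := bi m D E Dm Em => /(_ f) H.
  apply: le_trans (ler_wpM2r (normr_ge0 _) (b_sum D)) _.
  by rewrite -mulrA -!(mulrA 2) ler_wpM2l// mulrA.
rewrite [leRHS]mulrDl; apply: lerD; last first.
  by rewrite le_eqVlt; apply/orP; left; apply/eqP; ring.
under eq_bigr do rewrite mulrC.
apply: le_trans (bF B (fun n => xs n f)) _; rewrite -!mulrA ler_wpM2l//.
have -> : \sum_(n <- B) xs n f *: J (x n) = J (coord_proj x xs B f).
  by rewrite linear_sum; apply: eq_bigr => n _; rewrite linearZ.
apply: le_trans (JC _) _; rewrite ler_wpM2l//.
apply: (op_bound_abs q_norm (fun y : X => q_ge0 y) (T := coord_proj x xs B)).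
exact: qg.
Qed.

Lemma envelope_quasi_greedy : exists2 C : K, 0 <= C &
  forall (y : Xc) (A : {fset nat}), greedy_set ys A y ->
    `|coord_proj (J \o x) ys A y| <= C * `|y|.
Proof.
have [CJ CJ0 JC] := envelope_bounded q_norm hJ.
have [Cb Cb0 bi] := envelope_bidemocratic.
have [C1 C10 dqg] := dual_quasi_greedy.
have [_ [Cx [_ Cx0 _ xC]]] := semi_normalized_bounds.
have [I hI] := real_or_complex_imaginary_unit hK.
(* [C1] bounds the projection of the norming functional on a weakly greedy set [B] of its
   coefficients; the rest is the error in passing from [A] to [B]. *)
exists (C1 + 32 * (2 * (2 * Cb))); first by rewrite addr_ge0 ?mulr_ge0.
move=> y A Agr.
have [b [bF b_norming]] := norming_coefficients (J \o x) A (fun n => ys n y) hI supK.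
apply: le_trans b_norming _.
have b_sum (D : {fset nat}) : `|\sum_(n <- D) b n| <= 2 * `|\sum_(n <- D) J (x n)|.
  have := bF D (fun=> 1); under eq_bigr do rewrite mul1r.
  by under [in leRHS]eq_bigr do rewrite scale1r.
have b_bounded n : `|b n| <= 2 * (CJ * Cx).
  have := b_sum [fset n]%fset; rewrite !big_seq_fset1 => /le_trans; apply.
  rewrite ler_wpM2l//; apply: le_trans (JC _) _.
  by rewrite ler_wpM2l.
have [B BA Bgr] := @greedy_fset_exists K (fun n => `|b n|) 2 #|` A|
  (ler1n _ 2) (bounded_near_max (fun n => normr_ge0 _) supK b_bounded).
have := @norm_greedy_swap K I hI nat A B (fun n => ys n y) b (2 * Cb * `|y|) 2.
move=> /(_ _ (esym BA) _ Bgr _)/le_trans; apply.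
- by rewrite ler1n.
- move=> n k nB kB; apply: le_trans (Agr n k nB kB) _.
  by rewrite -[leLHS]mul1r ler_wpM2r// ler1n.
- move=> m D E Dm Em; have [_ /(_ y) H] := bi m E D Em Dm; rewrite mulrC.
  apply: le_trans (ler_wpM2r (normr_ge0 _) (b_sum E)) _.
  by rewrite -mulrA -!(mulrA 2) ler_wpM2l// mulrA.
rewrite [leRHS]mulrDl; apply: lerD; last first.
  by rewrite le_eqVlt; apply/orP; left; apply/eqP; ring.
by under eq_bigr do rewrite mulrC; exact: dqg.
Qed.

Lemma envelope_is_basis : is_basis normXc (J \o x) ys.
Proof.
have [CJ CJ0 JC] := envelope_bounded q_norm hJ.
case: qgreedy => -[dense _ biorth] _ _ _; split.
- move=> y e e0; have e2 : 0 < e / 2 by rewrite divr_gt0.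
  have [f yf] := envelope_dense q_norm hJ y e2.
  have CJ1 : 0 < CJ + 1 by rewrite ltr_wpDl.
  have [|N [c fc]] := dense f (e / 2 / (CJ + 1)); first by rewrite divr_gt0.
  exists N, c; rewrite /normXc -(subrKA (J f)) [ltRHS]splitr.
  apply: le_lt_trans (ler_normD _ _) _; apply: ltrD => //=.
  have -> : \sum_(i < N) c i *: J (x i) = J (\sum_(i < N) c i *: x i).
    by rewrite linear_sum; apply: eq_bigr => i _; rewrite linearZ.
  rewrite -linearB; apply: le_lt_trans (JC _) _.
  apply: (@le_lt_trans _ _ ((CJ + 1) * q (f - \sum_(i < N) c i *: x i))).
    by rewrite ler_wpM2r// lerDl.
  by rewrite mulrC -ltr_pdivlMr.
- by move=> n; exists (dual_norm q (xs n)) => y; exact: ys_le.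
- by move=> n k; rewrite /= ysJ biorth.
Qed.

Lemma envelope_dual_norm_le n : dual_norm normXc (ys n) <= dual_norm q (xs n).
Proof.
apply: (op_norm_le supK (quasi_norm_norm Xc)) => [a||y].
- exact: normr_ge0.
- exact: dual_ge0.
- exact: ys_le.
Qed.

Lemma envelope_M_bounded : M_bounded normXc (J \o x) ys.
Proof.
have [CJ CJ0 JC] := envelope_bounded q_norm hJ.
case: qgreedy => _ [M xM] _ _; exists (CJ * M) => n /=.
apply: le_trans (_ : CJ * q (x n) * dual_norm q (xs n) <= _).
  apply: ler_pM => //; last exact: envelope_dual_norm_le.
    exact: normr_ge0.
  apply: (op_norm_ge0 supK (quasi_norm_norm Xc)) => [a|]; first exact: normr_ge0.
  by exists (dual_norm q (xs n)) => y; exact: ys_le.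
by rewrite -mulrA ler_wpM2l.
Qed.

(** For the lower bound, 1 is the value of [ys n] at [J (x n)], and the functionals [ys n] are
    uniformly bounded. *)
Lemma envelope_semi_normalized : semi_normalized normXc (J \o x).
Proof.
have [CJ CJ0 JC] := envelope_bounded q_norm hJ.
have [L L0 Ln] := coordinate_dual_norm_bound.
have [c [C [c0 C0 _ xC]]] := semi_normalized_bounds.
case: qgreedy => -[_ _ biorth] _ _ _.
have L1 : 0 < L + 1 by rewrite ltr_wpDl.
exists (L + 1)^-1, (CJ * C); split; first by rewrite invr_gt0.
move=> n; split; last by apply: le_trans (JC _) _; rewrite ler_wpM2l.
rewrite -[_^-1]mul1r ler_pdivrMr// mulrC.
have := ys_le n (J (x n)); rewrite ysJ biorth eqxx normr1 => /le_trans; apply.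
by rewrite ler_wpM2r// (le_trans (Ln n))// lerDl.
Qed.

Lemma envelope_almost_greedy : almost_greedy_basis normXc (J \o x) ys.
Proof.
split; [exact: envelope_is_basis|exact: envelope_M_bounded
       |exact: envelope_semi_normalized|].
have [Cb Cb0 bi] := envelope_bidemocratic.
have [C2 C20 qg] := envelope_quasi_greedy.
have [I hI] := real_or_complex_imaginary_unit hK.
have [_ _ biorth] := envelope_is_basis.
(* [1 + C2] bounds [g] minus its projection on the difference of [A] and [B]; [16 * Cb] bounds the
   projection of [f] on the opposite difference. *)
exists (1 + C2 + 16 * Cb) => f A B Agr BA.
set g := f - coord_proj (J \o x) ys B f.
have g_coord k : ys k g = if k \in B then 0 else ys k f.
  have -> : ys k g = ys k f - \sum_(n <- B) ys n f * (n == k)%:R.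
    rewrite linearB linear_sum; congr (_ - _); apply: eq_bigr => n _.
    by rewrite linearZ /= biorth.
  case: ifPn => kB.
    rewrite (big_fsetD1 k kB) /= eqxx mulr1 big_seq big1 ?addr0 ?subrr// => n.
    by rewrite !inE => /andP[/negPf -> _]; rewrite mulr0.
  rewrite big_seq big1 ?subr0// => n nB; case: eqP => [nk|]; last by rewrite mulr0.
  by rewrite -nk nB in kB.
have f_g : f - coord_proj (J \o x) ys A f =
    g - coord_proj (J \o x) ys (A `\` B)%fset g
    + coord_proj (J \o x) ys (B `\` A)%fset f.
  have -> : coord_proj (J \o x) ys (A `\` B)%fset g
      = coord_proj (J \o x) ys (A `\` B)%fset f.
    rewrite /coord_proj big_seq [RHS]big_seq; apply: eq_bigr => n.
    by rewrite !inE => /andP[/negPf nB _]; rewrite g_coord nB.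
  have := sum_fsetB A B (fun n => ys n f *: (J \o x) n).
  rewrite -/(coord_proj _ _ A f) -/(coord_proj _ _ B f) => e.
  rewrite -/(coord_proj _ _ _ f) -/(coord_proj _ _ (B `\` A)%fset f) in e.
  by rewrite /g -addrA [X in _ = _ + X]addrC -[X in _ = _ + X]opprB -e opprB addrA subrK.
rewrite f_g [leRHS]mulrDl (mulrDl 1 C2) mul1r.
apply: le_trans (ler_normD _ _) _; apply: lerD.
  apply: le_trans (ler_normB _ _) _; rewrite lerD2l; apply: qg.
  move=> n k; rewrite !inE !g_coord => /andP[/negPf -> nA].
  case: ifP => kB; first by rewrite normr0.
  by move=> /= kA; exact: Agr.
have BA' : (#|` (B `\` A)%fset| <= #|` (A `\` B)%fset|)%N.
  by rewrite !cardfsD fsetIC leq_sub2r.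
have [D0|D0] := posnP #|` (A `\` B)%fset|.
  have -> : (B `\` A)%fset = fset0 by apply: cardfs0_eq; apply/eqP; rewrite -leqn0 -D0.
  by rewrite /normXc /coord_proj big_seq_fset0 normr0 !mulr_ge0.
(* Off [B] the coordinates of [g] are those of [f]. As [A] is greedy, they dominate on [A] minus [B]
   the coordinates of [f] on [B] minus [A], so averaging applies with [lam = 1]. *)
have := @norm_bilinear_sum_le K I hI nat Xc (B `\` A)%fset (A `\` B)%fset
  (fun n => J (x n)) (fun n => ys n g) (fun n => ys n f) (Cb * `|g|) 1 D0 ler01.
rewrite mul1r mulrA; apply.
- move=> E' D' E'E D'D; have [|//|_] := bi #|` (A `\` B)%fset| E' D'; last exact.
    exact: leq_trans (fsubset_leq_card E'E) BA'.
  exact: fsubset_leq_card.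
- move=> n k; rewrite !inE g_coord mul1r => /andP[nA nB] /andP[/negPf -> kA].
  exact: Agr.
Qed.

End BidemocraticBasis.

Theorem theorem9p16 (K : numFieldType) (hK : real_or_complex K)
    (X : lmodType K) (q : X -> K) (hX : quasi_banach q)
    (x : nat -> X) (xs : nat -> {scalar X})
    (hbd : bidemocratic_basis q x xs) (hqg : quasi_greedy_basis q x xs)
    (Xc : completeNormedModType K) (J : {linear X -> Xc})
    (hJ : is_banach_envelope q J) :
  exists ys : nat -> {scalar Xc},
    almost_greedy_basis (fun y : Xc => `|y|) (fun n => J (x n)) ys.
Proof.
have [q_norm _] := hX.
have [ys ysP] := dual_basis_exists hK q_norm hqg hJ; exists ys.
apply: (envelope_almost_greedy hK q_norm hbd hqg hJ) => n.
  by have [] := ysP n.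
by have [] := ysP n.
Qed.
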